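(* Let $X$ and $Y$ be proper Gromov hyperbolic geodesic spaces with base points $a\in X$, $b\in Y$, whose boundaries are equipped with visual metrics. If $g\colon\partial X\to\partial Y$ is a H\''older map and $X$ is visual, then there is $M>0$ such that each radial extension $f\colon X\to Y$ of $g$ with parameter $A\le M$ (where $A>0$) is a radial function.
   Context: For a metric space $(X,d)$ and $a,x,y\in X$ the Gromov product is $(x,y)_a=\frac12\big(d(x,a)+d(y,a)-d(x,y)\big)$. $X$ is (Gromov) hyperbolic if for some $\delta$ it satisfies $(x,y)_{x_0}\ge \min\{(x,z)_{x_0},(z,y)_{x_0}\}-\delta/4$ for all $x,y,z,x_0\in X$. Proper means that closed balls are compact. The boundary $\partial X$ of a proper hyperbolic geodesic space $X$ with basepoint $a$ is the set of sequences $(x_n)$ with $\liminf_{i,j\to\infty}(x_i,x_j)_a=\infty$, modulo $(x_n)\sim(y_n)$ iff $\liminf_{i,j\to\infty}(x_i,y_j)_a=\infty$. Equivalently, it is the set of geodesic rays $[0,\infty)\to X$ starting at $a$, modulo being at bounded distance; a ray $\xi$ represents the class $[\xi]=[(\xi(n))]$. For $p,q\in\partial X$, $(p,q)_a=\inf\liminf_{i\to\infty}(x_i,y_i)_a$ over all sequences with $p=[(x_i)]$, $q=[(y_i)]$. A metric $d$ on $\partial X$ is visual if there are $K,C>1$ with $\frac{K^{-(p,q)_a}}{C}\le d(p,q)\le C\,K^{-(p,q)_a}$ for all $p,q$. A map $g$ is H\''older if there are $A',B'>0$ with $d(g(p),g(q))\le B'd(p,q)^{A'}$ for all $p,q$.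 A hyperbolic space $X$ is visual if there is a constant $D>0$ (depending on the base point $a$) such that for each $x\in X$ there is an infinite geodesic ray $\xi$ at $a$ with $(x,\xi)_a>d(x,a)-D$, where $(x,\xi)_a=\liminf_{n\to\infty}(x,\xi(n))_a$. Fix such $D$. Given a function $g\colon\partial X\to\partial Y$ with $X$ visual, a radial extension $f\colon X\to Y$ of $g$ with parameter $A>0$ is a function obtained as follows: 1. $f(a)=b$. 2. If $x\in X\setminus\{a\}$ belongs to an infinite geodesic ray emanating from $a$, pick such a ray $\xi_x$, pick a geodesic ray $\eta_x$ emanating from $b$ with $[\eta_x]=g([\xi_x])$, and put $f(x)=\eta_x(A t_x)$, where $x=\xi_x(t_x)$. 3. For each remaining $x\in X$, pick a maximal (non-extendable) geodesic $\zeta_x\colon[0,M_x]\to X$ starting at $a$ and containing $x$, pick an infinite geodesic ray $\xi_x$ at $a$ with $(\zeta_x(M_x),\xi_x)_a>d(\zeta_x(M_x),a)-D$, pick a geodesic ray $\eta_x$ emanating from $b$ with $[\eta_x]=g([\xi_x])$, and put $f(x)=\eta_x(A t_x)$, where $x=\zeta_x(t_x)$. $f\colon X\to Y$ is large scale Lipschitz if there are $\lambda_1,\mu_1>0$ with $d(f(x),f(y))\le\lambda_1 d(x,y)+\mu_1$ for all $x,y$. It is radial (with respect to $x_0\in X$) if it is large scale Lipschitz and there are $\lambda_2,\mu_2>0$ such that for every finite geodesic $\gamma\colon[0,M']\to X$ with $\gamma(0)=x_0$, $\lambda_2 d(x,y)-\mu_2\le d(f(x),f(y))$ for all $x,y$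 in the image of $\gamma$; ''radial'' means radial with respect to some point of $X$. *)

(* Defs.v *)
From HB Require Import structures.
From mathcomp Require Import all_boot all_order all_algebra.
From mathcomp Require Import all_classical all_reals all_analysis.

Set Implicit Arguments.
Unset Strict Implicit.
Unset Printing Implicit Defensive.

Import Order.TTheory GRing.Theory Num.Theory.
Import numFieldNormedType.Exports.

Local Open Scope classical_set_scope.
Local Open Scope ring_scope.

Section HyperbolicSpaces.
Context {R : realType}.
Implicit Types X Y : metricType R.

Definition gromov_product X (a x y : X) : R :=
  (mdist x a + mdist y a - mdist x y) / 2.

Definition hyperbolic X : Prop :=
  exists delta : R, forall x y z x0 : X,
    gromov_product x0 x y >=
      Num.min (gromov_product x0 x z) (gromov_product x0 z y) - delta / 4.

Definition proper_space X : Prop :=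
  forall (x : X) (r : R), compact [set y : X | mdist x y <= r].

(* Geodesics are total functions R -> X whose values outside [0, M]
   (outside [0, +oo[ for rays) are irrelevant. *)
Definition geodesic X (M : R) (gamma : R -> X) : Prop :=
  0 <= M /\ forall s t : R, 0 <= s <= M -> 0 <= t <= M ->
    mdist (gamma s) (gamma t) = `|s - t|.

Definition geodesic_ray X (a : X) (xi : R -> X) : Prop :=
  xi 0 = a /\ forall s t : R, 0 <= s -> 0 <= t ->
    mdist (xi s) (xi t) = `|s - t|.

Definition geodesic_space X : Prop :=
  forall x y : X, exists M gamma,
    [/\ geodesic M gamma, gamma 0 = x & gamma M = y].

Definition maximal_geodesic X (M : R) (zeta : R -> X) : Prop :=
  geodesic M zeta /\
  ~ exists M' zeta', [/\ M < M', geodesic M' zeta' &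
      forall t : R, 0 <= t <= M -> zeta' t = zeta t].

Definition liminf_gromov2 X (a : X) (x y : nat -> X) : \bar R :=
  limf_einf (fun ij : nat * nat => (gromov_product a (x ij.1) (y ij.2))%:E)
    (filter_prod \oo \oo).

Definition to_infinity X (a : X) (x : nat -> X) : Prop :=
  liminf_gromov2 a x x = +oo%E.

Definition boundary_class X (a : X) (x : nat -> X) : set (nat -> X) :=
  [set y | to_infinity a y /\ liminf_gromov2 a x y = +oo%E].

Definition boundary X (a : X) : Type :=
  {p : set (nat -> X) |
    exists2 x, to_infinity a x & p = boundary_class a x}.

(* [p = [(x_n)]] *)
Definition represents X (a : X) (x : nat -> X) (p : boundary a) : Prop :=
  sval p x.

(* [p = [xi]], for a ray [xi] *)
Definition ray_end X (a : X) (xi : R -> X) (p : boundary a) : Prop :=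
  represents (fun n => xi n%:R) p.

Definition boundary_product X (a : X) (p q : boundary a) : \bar R :=
  ereal_inf [set l | exists x y, [/\ represents x p, represents y q &
    l = limn_einf (fun i => (gromov_product a (x i) (y i))%:E)]].

(* K ^ (- t), with K ^ (- oo) = 0, which is needed for t = (p, p)_a = +oo. The
   value at t = -oo is irrelevant: Gromov products are nonnegative. *)
Definition pow_opp (K : R) (t : \bar R) : R :=
  if t is r%:E then K `^ (- r) else 0.

Definition is_metric (T : Type) (d : T -> T -> R) : Prop :=
  [/\ forall p q, 0 <= d p q,
      forall p q, d p q = 0 <-> p = q,
      forall p q, d p q = d q p &
      forall p q r, d p r <= d p q + d q r].

Definition visual_metric X (a : X) (d : boundary a -> boundary a -> R) : Prop :=
  is_metric d /\
  exists K C : R, [/\ 1 < K, 1 < C & forall p q : boundary a,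
    pow_opp K (boundary_product p q) / C <= d p q
      <= C * pow_opp K (boundary_product p q)].

Definition hoelder_map (S T : Type) (dS : S -> S -> R) (dT : T -> T -> R)
    (g : S -> T) : Prop :=
  exists A' B' : R, [/\ 0 < A', 0 < B' &
    forall p q, dT (g p) (g q) <= B' * dS p q `^ A'].

Definition ray_product X (a x : X) (xi : R -> X) : \bar R :=
  limn_einf (fun n => (gromov_product a x (xi n%:R))%:E).

Definition visual_ray X (a : X) (D : R) (x : X) (xi : R -> X) : Prop :=
  geodesic_ray a xi /\ (ray_product a x xi > (mdist x a - D)%:E)%E.

Definition visual_space X (a : X) (D : R) : Prop :=
  0 < D /\ forall x : X, exists xi, visual_ray a D x xi.

(* [eta] is a ray at [b] with [[eta] = g [xi]] *)
Definition image_ray X Y (a : X) (b : Y) (g : boundary a -> boundary b)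
    (xi : R -> X) (eta : R -> Y) : Prop :=
  geodesic_ray b eta /\ exists2 p, ray_end xi p & ray_end eta (g p).

Definition on_ray X (a x : X) : Prop :=
  exists xi t, [/\ geodesic_ray a xi, 0 <= t & x = xi t].

(* The choices of [zeta_x], [xi_x], [eta_x] are made independently at each [x],
   hence are existentially quantified at each [x]. *)
Definition radial_extension X Y (a : X) (b : Y) (D : R)
    (g : boundary a -> boundary b) (A : R) (f : X -> Y) : Prop :=
  [/\ f a = b,
      forall x, x <> a -> on_ray a x ->
        exists xi eta t,
          [/\ geodesic_ray a xi, 0 <= t, x = xi t,
              image_ray g xi eta & f x = eta (A * t)] &
      forall x, x <> a -> ~ on_ray a x ->
        exists M zeta t xi eta,
          [/\ maximal_geodesic M zeta /\ zeta 0 = a,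
              0 <= t <= M /\ x = zeta t,
              visual_ray a D (zeta M) xi,
              image_ray g xi eta & f x = eta (A * t)]].

Definition large_scale_lipschitz X Y (f : X -> Y) : Prop :=
  exists lambda mu : R, [/\ 0 < lambda, 0 < mu &
    forall x y, mdist (f x) (f y) <= lambda * mdist x y + mu].

Definition radial_at X Y (x0 : X) (f : X -> Y) : Prop :=
  large_scale_lipschitz f /\
  exists lambda mu : R, [/\ 0 < lambda, 0 < mu &
    forall M' gamma, geodesic M' gamma -> gamma 0 = x0 ->
      forall s t : R, 0 <= s <= M' -> 0 <= t <= M' ->
        lambda * mdist (gamma s) (gamma t) - mu
          <= mdist (f (gamma s)) (f (gamma t))].

Definition radial X Y (f : X -> Y) : Prop := exists x0 : X, radial_at x0 f.

End HyperbolicSpaces.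

(* Main.v *)
Require Import Defs.
From HB Require Import structures.
From mathcomp Require Import all_boot all_order all_algebra.
From mathcomp Require Import all_classical all_reals all_analysis.
From mathcomp Require Import lra.

Set Implicit Arguments.
Unset Strict Implicit.

Import Order.TTheory GRing.Theory Num.Theory.
Import numFieldNormedType.Exports.

Local Open Scope ring_scope.

(** The lower bound is immediate since [d (f x, b) = A * d (x, a)]. For the
    upper bound, let [p] and [q] be the ends of the rays chosen at [x] and [y].
    These rays pass near [x] and [y], so [(p, q)_a >= (x, y)_a - const]. As
    both metrics are visual, the Hoelder condition reads
    [(g p, g q)_b >= c * (p, q)_a - const] with
    [c = A' * ln K_X / ln K_Y]; this [c] is [M]. Since [f x] and [f y] lie on
    rays towards [g p] and [g q] at heights [A * d (x, a)] and [A * d (y, a)],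
    hyperbolicity of [Y] gives [(f x, f y)_b >= A * (x, y)_a - const] when
    [A <= c], and this is the Lipschitz bound. *)

Section LimfEinf.
Context {R : realType} {T : choiceType} {U : filteredType T}.
Implicit Types (u : U -> \bar R) (F : set_system U).

Lemma lt_limf_einf u F (r : R) : (r%:E < limf_einf u F)%E ->
  exists2 V, F V & forall x, V x -> (r%:E < u x)%E.
Proof.
rewrite limf_einfE => /ereal_sup_gt[_ [V FV <-] rV].
exists V => // x Vx; apply: (lt_le_trans rV).
by apply: ereal_inf_lbound; exists x.
Qed.

Lemma limf_einf_ge u F V (r : \bar R) : F V -> (forall x, V x -> (r <= u x)%E) ->
  (r <= limf_einf u F)%E.
Proof.
move=> FV rV; rewrite limf_einfE.
apply: (@le_trans _ _ (ereal_inf [set u x | x in V]%classic)).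
  by apply: le_ereal_inf_tmp => _ [x Vx <-]; exact: rV.
by apply: ereal_sup_ubound; exists V.
Qed.

End LimfEinf.

Section LimnEinf.
Context {R : realType}.
Implicit Type u : nat -> \bar R.

Lemma lt_limn_einf u (r : R) : (r%:E < limn_einf u)%E ->
  exists N, forall n, (N <= n)%N -> (r%:E < u n)%E.
Proof. by move=> /lt_limf_einf[V [N _ NV] rV]; exists N => n /NV /rV. Qed.

Lemma limn_einf_ge u (r : \bar R) N :
  (forall n, (N <= n)%N -> (r <= u n)%E) -> (r <= limn_einf u)%E.
Proof.
move=> ru; apply: (@limf_einf_ge _ _ _ _ _ [set n | (N <= n)%N]%classic) => //.
by exists N.
Qed.

End LimnEinf.

Section GromovProduct.
Context {R : realType} {X : metricType R}.
Implicit Types a x y z : X.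

Lemma gromov_productC a x y : gromov_product a x y = gromov_product a y x.
Proof. by rewrite /gromov_product (metric_sym x y) (addrC (mdist x a)). Qed.

Lemma gromov_product_ge0 a x y : 0 <= gromov_product a x y.
Proof.
have := metric_triangle x a y; rewrite (metric_sym a y) /gromov_product.
lra.
Qed.

Lemma gromov_product_lel a x y : gromov_product a x y <= mdist x a.
Proof.
have := metric_triangle y x a; rewrite (metric_sym y x) /gromov_product.
lra.
Qed.

Lemma gromov_product_ler a x y : gromov_product a x y <= mdist y a.
Proof. by rewrite gromov_productC gromov_product_lel. Qed.

Definition hyperbolic_at a (h : R) := forall x y z r,
  r <= gromov_product a x z -> r <= gromov_product a z y ->
  r - h <= gromov_product a x y.

Lemma hyperbolicP a : hyperbolic X -> exists2 h, 0 <= h & hyperbolic_at a h.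
Proof.
move=> [delta hyp]; exists (Num.max (delta / 4) 0); first by rewrite le_max lexx orbT.
move=> x y z r rxz rzy; apply: le_trans (hyp x y z a).
by apply: lerB; rewrite ?le_min ?rxz ?rzy// le_max lexx.
Qed.

Lemma hyperbolic_at2 a h x x' y' y r : 0 <= h -> hyperbolic_at a h ->
  r <= gromov_product a x x' -> r <= gromov_product a x' y' ->
  r <= gromov_product a y' y -> r - 2 * h <= gromov_product a x y.
Proof.
move=> h0 hyp rx rxy ry; have -> : r - 2 * h = r - h - h by lra.
by apply: (hyp _ _ y'); [exact: (hyp _ _ x')|lra].
Qed.

Lemma geodesic_ray_mdist a (xi : R -> X) t : geodesic_ray a xi -> 0 <= t ->
  mdist (xi t) a = t.
Proof. by move=> [<- xiP] t0; rewrite xiP// subr0 ger0_norm. Qed.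

Lemma geodesic_mdist M gamma t : geodesic M gamma -> 0 <= t <= M ->
  mdist (gamma t : X) (gamma 0) = t.
Proof.
move=> [M0 geo] tM; rewrite geo// ?lexx// subr0 ger0_norm//.
by case/andP: tM.
Qed.

Lemma gromov_product_geodesic M gamma t : geodesic M gamma -> 0 <= t <= M ->
  gromov_product (gamma 0 : X) (gamma t) (gamma M) = t.
Proof.
move=> geo tM; have [M0 gP] := geo; case/andP: (tM) => t0 tM'.
rewrite /gromov_product !(geodesic_mdist geo)// ?M0 ?lexx//.
rewrite gP// ?M0 ?lexx// ler0_norm; lra.
Qed.

Lemma geodesic_ray_geodesic a (xi : R -> X) M : geodesic_ray a xi -> 0 <= M ->
  geodesic M xi.
Proof.
by move=> [_ xiP] M0; split=> // s t /andP[s0 _] /andP[t0 _]; exact: xiP.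
Qed.

Lemma gromov_product_ray a (xi : R -> X) s t : geodesic_ray a xi ->
  0 <= s <= t -> gromov_product a (xi s) (xi t) = s.
Proof.
move=> ray st; case/andP: (st) => s0 sle; have t0 := le_trans s0 sle.
rewrite -{1}ray.1; apply: gromov_product_geodesic st.
exact: geodesic_ray_geodesic ray t0.
Qed.

End GromovProduct.

Section Boundary.
Context {R : realType} {X : metricType R} {a : X} {h : R}.
Hypotheses (h0 : 0 <= h) (hyp : hyperbolic_at a h).
Implicit Types (x y : nat -> X) (p q : boundary a).

Lemma liminf_gromov2_pinfty x y : liminf_gromov2 a x y = +oo%E ->
  forall r, exists N, forall i j, (N <= i)%N -> (N <= j)%N ->
    r < gromov_product a (x i) (y j).
Proof.
move=> xy r.
have /lt_limf_einf[V [[P Q] /= [[N1 _ NP] [N2 _ NQ]] PQV] rV] :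
  (r%:E < liminf_gromov2 a x y)%E by rewrite xy ltry.
exists (maxn N1 N2) => i j; rewrite !geq_max => /andP[i1 i2] /andP[j1 j2].
rewrite -lte_fin; apply: (rV (i, j)); apply: PQV.
by split; [exact: NP|exact: NQ].
Qed.

Lemma represents_gromov_product p x y : represents x p -> represents y p ->
  forall r, exists N, forall i j, (N <= i)%N -> (N <= j)%N ->
    r <= gromov_product a (x i) (y j).
Proof.
case: p => S [z zoo SE]; rewrite /represents /= SE => -[_ zx] [_ zy] r.
have [N1 N1P] := liminf_gromov2_pinfty zx (r + h).
have [N2 N2P] := liminf_gromov2_pinfty zy (r + h).
exists (maxn N1 N2) => i j; rewrite !geq_max => /andP[i1 i2] /andP[j1 j2].
have -> : r = r + h - h by lra.
apply: (@hyp _ _ (z (maxn N1 N2))).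
  by rewrite gromov_productC ltW// N1P// leq_maxl.
by rewrite ltW// N2P// leq_maxr.
Qed.

Lemma boundary_product_ge p q x y r : represents x p -> represents y q ->
  (exists N, forall n, (N <= n)%N -> r <= gromov_product a (x n) (y n)) ->
  ((r - 2 * h)%:E <= boundary_product p q)%E.
Proof.
move=> xp yq [N NP]; apply: le_ereal_inf_tmp => _ [x' [y' [x'p y'q ->]]].
have [N1 N1P] := represents_gromov_product x'p xp r.
have [N2 N2P] := represents_gromov_product yq y'q r.
apply: (@limn_einf_ge _ _ _ (maxn N (maxn N1 N2))) => n.
rewrite !geq_max => /and3P[nN n1 n2]; rewrite lee_fin.
exact: hyperbolic_at2 h0 hyp (N1P _ _ n1 n1) (NP _ nN) (N2P _ _ n2 n2).
Qed.

Lemma boundary_product_ge0 p q : (0 <= boundary_product p q)%E.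
Proof.
apply: le_ereal_inf_tmp => _ [x [y [_ _ ->]]].
by apply: (@limn_einf_ge _ _ _ 0) => n _; rewrite lee_fin gromov_product_ge0.
Qed.

Lemma lt_boundary_product p q x y r : represents x p -> represents y q ->
  (r%:E < boundary_product p q)%E ->
  exists N, forall n, (N <= n)%N -> r < gromov_product a (x n) (y n).
Proof.
move=> xp yq rpq.
have /lt_limn_einf[N NP] :
    (r%:E < limn_einf (fun i => (gromov_product a (x i) (y i))%:E))%E.
  by apply: lt_le_trans rpq _; apply: ereal_inf_lbound; exists x, y.
by exists N => n /NP; rewrite lte_fin.
Qed.

End Boundary.

Lemma hoelder_boundary_product (R : realType) (X Y : metricType R)
    (a : X) (b : Y) (dX : boundary a -> boundary a -> R)
    (dY : boundary b -> boundary b -> R) (g : boundary a -> boundary b) :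
  visual_metric dX -> visual_metric dY -> hoelder_map dX dY g ->
  exists c k : R, 0 < c /\ forall p q r, (r%:E <= boundary_product p q)%E ->
    ((c * r - k)%:E <= boundary_product (g p) (g q))%E.
Proof.
move=> [[dX_ge0 _ _ _] [K [C [K1 C1 dXP]]]] [_ [L [E [L1 E1 dYP]]]].
move=> [A' [B' [A'0 B'0 gP]]].
have lnK : 0 < ln K by rewrite ln_gt0.
have lnL : 0 < ln L by rewrite ln_gt0.
have C0 : 0 < C by lra.
have E0 : 0 < E by lra.
have K0 : 0 < K by lra.
have L0 : 0 < L by lra.
exists (A' * ln K / ln L), ((ln E + ln B' + A' * ln C) / ln L).
split; first by rewrite divr_gt0// mulr_gt0.
move=> p q r rpq.
have dXpq : dX p q <= C * K `^ (- r).
  apply: le_trans (andP (dXP p q)).2 _; rewrite ler_pM2l//.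
  case: (boundary_product p q) rpq => [s| |] //=.
    by rewrite lee_fin => rs; apply: ler_powR; rewrite ?lerN2// ltW.
  by rewrite powR_ge0.
have dYpq : pow_opp L (boundary_product (g p) (g q)) <=
    E * (B' * (C * K `^ (- r)) `^ A').
  have := (andP (dYP (g p) (g q))).1; rewrite ler_pdivrMr// mulrC => /le_trans.
  apply; rewrite ler_pM2l//; apply: le_trans (gP p q) _; rewrite ler_pM2l//.
  by apply: ge0_ler_powR dXpq; rewrite ?nnegrE ?dX_ge0 ?mulr_ge0 ?powR_ge0 ?ltW.
have := boundary_product_ge0 (g p) (g q).
case: (boundary_product (g p) (g q)) dYpq => [s| |] //=; last by move=> *; exact: leey.
have K0r : 0 < K `^ (- r) by exact: powR_gt0.
have CK0 : 0 < (C * K `^ (- r)) `^ A' by rewrite powR_gt0// mulr_gt0.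
rewrite -ler_ln ?posrE ?powR_gt0 ?mulr_gt0//.
rewrite !lnM ?posrE ?powR_gt0 ?mulr_gt0// !ln_powR lnM ?posrE// ln_powR.
move=> sr _; rewrite lee_fin mulrAC -mulrBl ler_pdivrMr//; lra.
Qed.

Lemma radial_extension_rays (R : realType) (X Y : metricType R) (a : X) (b : Y)
    (h D A : R) (g : boundary a -> boundary b) (f : X -> Y) :
  0 <= h -> hyperbolic_at a h -> 0 < D -> radial_extension D g A f ->
  forall x, x <> a -> exists xi eta,
    [/\ image_ray g xi eta, f x = eta (A * mdist x a) &
      exists N, forall n, (N <= n)%N ->
        mdist x a - (D + h) <= gromov_product a x (xi n%:R)].
Proof.
move=> h0 hyp D0 [_ f_ray f_nray] x xa.
have [/(f_ray x xa)|/(f_nray x xa)] := EM (on_ray a x).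
  move=> [xi [eta [t [ray t0 xE im fx]]]]; exists xi, eta.
  have dx : mdist x a = t by rewrite xE; exact: geodesic_ray_mdist.
  rewrite dx; split => //; have [N tN] : exists N : nat, t <= N%:R.
    by exists (Num.bound t); rewrite ltW// archi_boundP.
  exists N => n Nn; rewrite xE (gromov_product_ray ray); first by lra.
  by rewrite t0 (le_trans tN)// ler_nat.
move=> [M [zeta [t [xi [eta [[[geo _] zeta0] [tM xE] [ray vis] im fx]]]]]].
have M0 := geo.1.
exists xi, eta.
have dx : mdist x a = t by rewrite xE -zeta0; exact: geodesic_mdist geo tM.
rewrite dx; split => //; have [N NP] := lt_limn_einf vis; exists N => n /NP.
rewrite lte_fin -[in mdist _ _]zeta0 (geodesic_mdist geo) ?M0 ?lexx// => MD.
have -> : t - (D + h) = t - D - h by lra.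
apply: (hyp _ _ (zeta M)).
  by rewrite xE -zeta0 (gromov_product_geodesic geo)//; lra.
by case/andP: tM => _ tM; lra.
Qed.

Theorem theorem4p4 (R : realType) (X Y : metricType R) (a : X) (b : Y)
    (properX : proper_space X) (hypX : hyperbolic X) (geoX : geodesic_space X)
    (properY : proper_space Y) (hypY : hyperbolic Y) (geoY : geodesic_space Y)
    (dX : boundary a -> boundary a -> R) (dY : boundary b -> boundary b -> R)
    (visdX : visual_metric dX) (visdY : visual_metric dY)
    (D : R) (visX : visual_space a D)
    (g : boundary a -> boundary b) (hoelder_g : hoelder_map dX dY g) :
  exists2 M : R, 0 < M & forall (A : R) (f : X -> Y), 0 < A -> A <= M ->
    radial_extension D g A f -> radial f.
Proof.
have [h h0 hypXh] := hyperbolicP a hypX.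
have [h' h'0 hypYh] := hyperbolicP b hypY.
have [c [k [c0 ck]]] := hoelder_boundary_product visdX visdY hoelder_g.
exists c => // A f A0 Ac fext; have [fa _ _] := fext; have [D0 _] := visX.
have rays := radial_extension_rays h0 hypXh D0 fext.
have dfb x : mdist (f x) b = A * mdist x a.
  have [->|/eqP xa] := eqVneq x a; first by rewrite fa !mdistxx mulr0.
  have [xi [eta [[ray _] -> _]]] := rays x xa.
  by rewrite (geodesic_ray_mdist ray)// mulr_ge0 ?mdist_ge0 ?ltW.
exists a; split; last first.
  exists A, 1; split => // M' gamma geo gamma0 s t sM tM.
  have [_ geoP] := geo.
  have := dfb (gamma s); have := dfb (gamma t).
  rewrite -[in mdist (gamma _) a]gamma0 !(geodesic_mdist geo)//.
  rewrite -[in mdist (gamma s) a]gamma0 !(geodesic_mdist geo)//.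
  have := metric_triangle (f (gamma s)) (f (gamma t)) b.
  have := metric_triangle (f (gamma t)) (f (gamma s)) b.
  rewrite (metric_sym (f (gamma t)) (f (gamma s))) geoP//.
  by have [st|st] := leP s t; [rewrite ler0_norm|rewrite gtr0_norm]; lra.
have [mu mu0 fmu] : exists2 mu, 0 <= mu & forall x y, x <> a -> y <> a ->
    A * gromov_product a x y - mu <= gromov_product b (f x) (f y).
  pose e := `|c * (D + 5 * h) + k| + 1.
  exists (e + 2 * h') => [|x y xa ya]; first by rewrite /e addr_ge0// mulr_ge0.
  have [xi [eta [[etaray [p xip etap]] fx [N NP]]]] := rays x xa.
  have [xi' [eta' [[etaray' [q xiq etaq]] fy [N' NP']]]] := rays y ya.
  set r := gromov_product a x y; have r0 : 0 <= r by exact: gromov_product_ge0.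
  have rx : r <= mdist x a := gromov_product_lel a x y.
  have ry : r <= mdist y a := gromov_product_ler a x y.
  have pq : ((r - (D + h) - 2 * h - 2 * h)%:E <= boundary_product p q)%E.
    apply: (boundary_product_ge h0 hypXh xip xiq).
    exists (maxn N N') => n; rewrite geq_max => /andP[nN nN'].
    apply: (hyperbolic_at2 (x' := x) (y' := y) h0 hypXh).
    - by rewrite gromov_productC; have := NP n nN; lra.
    - by rewrite -/r; lra.
    - by have := NP' n nN'; lra.
  have Ar : A * r <= c * r by rewrite ler_wpM2r.
  have gpq : ((A * r - e)%:E < boundary_product (g p) (g q))%E.
    apply: lt_le_trans (ck _ _ _ pq); rewrite lte_fin /e.
    have := ler_norm (c * (D + 5 * h) + k); lra.
  have [N1 N1P] := lt_boundary_product etap etaq gpq.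
  have e0 : 0 <= e by rewrite /e addr_ge0.
  have Arx : A * r <= A * mdist x a by rewrite ler_pM2l.
  have Ary : A * r <= A * mdist y a by rewrite ler_pM2l.
  pose n := maxn N1 (Num.bound (A * mdist x a + A * mdist y a)).
  have Ax0 : 0 <= A * mdist x a by rewrite mulr_ge0 ?mdist_ge0 ?ltW.
  have Ay0 : 0 <= A * mdist y a by rewrite mulr_ge0 ?mdist_ge0 ?ltW.
  have nA : A * mdist x a + A * mdist y a <= n%:R.
    rewrite (le_trans (ltW (archi_boundP _)))// ?addr_ge0//.
    by rewrite ler_nat leq_maxr.
  rewrite opprD addrA fx fy.
  apply: (hyperbolic_at2 (x' := eta n%:R) (y' := eta' n%:R) h'0 hypYh).
  - by rewrite (gromov_product_ray etaray) ?Ax0; lra.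
  - by rewrite ltW// N1P// leq_maxl.
  - by rewrite gromov_productC (gromov_product_ray etaray') ?Ay0; lra.
exists A, (2 * mu + 1); split => // [|x y]; first by lra.
have [->|/eqP xa] := eqVneq x a.
  by rewrite fa metric_sym dfb metric_sym; lra.
have [->|/eqP ya] := eqVneq y a.
  by rewrite fa dfb; lra.
have := fmu x y xa ya; rewrite /gromov_product !dfb; lra.
Qed.
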